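(* Let $V$ be a finite-dimensional complex vector space and let $N$ be a non-zero nilpotent linear transformation on $V$. For every $x\in V$ the cyclic subspace $(N)_x$ is a cycle in $\mathrm{Lat}(N)$.
   Context: $\mathrm{Lat}(N)$ is the lattice (ordered by inclusion) of all subspaces $M\subseteq V$ with $NM\subseteq M$. For $x\in V$, $(N)_x=\{p(N)x:\ p\in\mathbb{C}[z]\}$ is the cyclic subspace of $N$ generated by $x$. For $M_1,M_2\in\mathrm{Lat}(N)$, the interval is $[M_1,M_2]=\{P\in\mathrm{Lat}(N):\ M_1\subseteq P\subseteq M_2\}$. A subspace $M\in\mathrm{Lat}(N)$ is a cycle if $[\{0\},M]$ is a finite chain (a finite totally ordered set) in $\mathrm{Lat}(N)$. *)

(* Defs.v *)
From HB Require Import structures.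
From mathcomp Require Import all_boot all_order all_algebra.
From mathcomp Require Import complex.
From mathcomp Require Import boolp classical_sets cardinality reals.

Set Implicit Arguments.
Unset Strict Implicit.
Unset Printing Implicit Defensive.

Import GRing.Theory.

Local Open Scope ring_scope.
Local Open Scope classical_set_scope.

Section LinearMaps.
Variables (K : fieldType) (V : vectType K).
Implicit Types (N : 'End(V)) (M P Q U : {vspace V}) (x y : V) (p q : {poly K}).

(* 'End(V) has no canonical ring structure (V may be 0), so powers and
   polynomials in an endomorphism are written with composition. *)
Definition lfun_exp N (k : nat) : 'End(V) := iter k (comp_lfun N) \1%VF.

Definition lfun_horner N p : 'End(V) :=
  \sum_(i < size p) p`_i *: lfun_exp N i.

Definition lfun_nilpotent N : Prop := exists k : nat, lfun_exp N k = 0.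

Definition Lat N : set {vspace V} := [set M | (N @: M <= M)%VS].

Definition Lat_itv N M1 M2 : set {vspace V} :=
  [set P | [/\ Lat N P, (M1 <= P)%VS & (P <= M2)%VS]].

Definition is_cycle N M : Prop :=
  [/\ Lat N M, finite_set (Lat_itv N 0%VS M) &
      total_on (Lat_itv N 0%VS M) (fun P Q => (P <= Q)%VS)].

Lemma vspace_of_submod (A : set V) :
    A 0 -> (forall (a : K) x y, A x -> A y -> A (a *: x + y)) ->
  exists U, forall y, y \in U <-> A y.
Proof.
move=> A0 AL.
pose S (d : nat) := `[< exists U, \dim U = d /\ (forall y, y \in U -> A y) >].
have S0 : exists d, S d.
  exists 0%N; apply/asboolP; exists 0%VS; split; first by rewrite dimv0.
  by move=> y; rewrite memv0 => /eqP ->.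
have Sle d : S d -> (d <= \dim {: V})%N.
  by move=> /asboolP [U [<- _]]; exact: dimvS (subvf U).
case: (ex_maxnP S0 Sle) => d /asboolP [U [dU UA]] dmax.
exists U => y; split; first exact: UA.
move=> Ay; apply: contrapT => /negP yU.
have SS : S (\dim (<[y]> + U)).
  apply/asboolP; exists (<[y]> + U)%VS; split=> // z.
  case/memv_addP => u /vlineP [a ->] [v vU ->].
  by apply: AL => //; exact: UA.
have := dmax _ SS; rewrite -dU leqNgt => /negP; apply.
rewrite ltn_neqAle dimvS ?addvSr // andbT.
apply/negP => /eqP e; move/negP: yU; apply.
have /eqP -> : U == (<[y]> + U)%VS by rewrite eqEdim addvSr -e leqnn.
by apply: subvP (addvSl _ _) _ (memv_line y).
Qed.

Lemma lfun_horner_widen N p n : (size p <= n)%N ->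
  lfun_horner N p = \sum_(i < n) p`_i *: lfun_exp N i.
Proof.
move=> le_pn; rewrite /lfun_horner.
rewrite (big_ord_widen n (fun i => p`_i *: lfun_exp N i)) // big_mkcond /=.
apply: eq_bigr => i _; case: ltnP => // /leq_sizeP -> //.
by rewrite scale0r.
Qed.

Lemma lfun_horner_is_linear N (a : K) p q :
  lfun_horner N (a *: p + q) = a *: lfun_horner N p + lfun_horner N q.
Proof.
pose n := maxn (size (a *: p + q)) (maxn (size p) (size q)).
rewrite !(@lfun_horner_widen N _ n) /n ?leq_max ?leqnn ?orbT //.
rewrite scaler_sumr -big_split /=; apply: eq_bigr => i _.
by rewrite coefD coefZ scalerDl scalerA.
Qed.

Lemma cyclic_subproof N x :
  exists U, forall y, y \in U <-> exists p, y = lfun_horner N p x.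
Proof.
apply: (@vspace_of_submod [set y | exists p, y = lfun_horner N p x]).
  by exists 0; rewrite /lfun_horner size_poly0 big_ord0 zero_lfunE.
move=> a _ _ [p ->] [q ->]; exists (a *: p + q).
by rewrite lfun_horner_is_linear add_lfunE scale_lfunE.
Qed.

(* The subspace (N)_x whose set of elements is {p(N) x : p in K[z]}. *)
Definition cyclic N x : {vspace V} := sval (cid (cyclic_subproof N x)).

Lemma mem_cyclic N x y : y \in cyclic N x <-> exists p, y = lfun_horner N p x.
Proof. by rewrite /cyclic; case: cid. Qed.

End LinearMaps.

(* Main.v *)
Require Import Defs.
From HB Require Import structures.
From mathcomp Require Import all_boot all_order all_algebra.
From mathcomp Require Import complex.
From mathcomp Require Import boolp classical_sets cardinality reals.

(** Write C = (N)_x. Since C = <x> + N C, an invariant P inside C either lies in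
    N C = (N)_{N x}, or satisfies C = P + N C, and then P = C because N is
    nilpotent at x (Nakayama). By induction on the nilpotency index, every
    invariant subspace of C is one of the decreasing finite family (N)_{N^k x}. *)

Local Open Scope ring_scope.
Local Open Scope complex_scope.

Section CyclicSubspaces.
Import GRing.Theory.
Context {K : fieldType} {V : vectType K}.
Implicit Types (N : 'End(V)) (P : {vspace V}) (x y : V).

Lemma lfun_expE N k x : lfun_exp N k x = iter k N x.
Proof. by elim: k => [|k IH] /=; rewrite ?id_lfunE // comp_lfunE IH. Qed.

Lemma lfun_horner_mulX N (p : {poly K}) x :
  lfun_horner N (p * 'X) x = N (lfun_horner N p x).
Proof.
(* At [p = 0] the size of [p * 'X] is smaller than [(size p).+1]; padding to that length treats all
   [p] alike. *)
rewrite (@lfun_horner_widen _ _ _ _ (size p).+1) ?size_polyMleq //; last first.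
  by apply: leq_trans (size_polyMleq _ _) _; rewrite size_polyX addn2.
rewrite big_ord_recl coefMX /= scale0r add0r /lfun_horner !sum_lfunE linear_sum.
by apply: eq_bigr => i _; rewrite coefMX /= !scale_lfunE linearZ /= comp_lfunE.
Qed.

Lemma Lat_iter_mem N P k x : Lat N P -> x \in P -> iter k N x \in P.
Proof.
move=> LP xP; elim: k => //= k IH.
by apply: (subvP LP); exact: memv_img.
Qed.

Lemma mem_cyclic_gen N x : x \in cyclic N x.
Proof.
apply/mem_cyclic; exists 1.
by rewrite /lfun_horner size_poly1 big_ord1 coef1 scale1r id_lfunE.
Qed.

Lemma Lat_cyclic N x : Lat N (cyclic N x).
Proof.
apply/subvP => _ /memv_imgP [y /mem_cyclic [p ->] ->].
by apply/mem_cyclic; exists (p * 'X); rewrite lfun_horner_mulX.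
Qed.

Lemma cyclic_min N P x : Lat N P -> x \in P -> (cyclic N x <= P)%VS.
Proof.
move=> LP xP; apply/subvP => _ /mem_cyclic [p ->].
rewrite /lfun_horner sum_lfunE; apply: memv_suml => i _.
by rewrite scale_lfunE lfun_expE memvZ // Lat_iter_mem.
Qed.

Lemma cyclic_iter_le N x i j : (i <= j)%N ->
  (cyclic N (iter j N x) <= cyclic N (iter i N x))%VS.
Proof.
move=> /subnK <-; rewrite iterD; apply: cyclic_min (Lat_cyclic _ _) _.
exact: Lat_iter_mem (Lat_cyclic _ _) (mem_cyclic_gen _ _).
Qed.

(** Both inclusions follow from minimality: the preimage of (N)_{N x} under N is invariant and
    contains x, while the image of (N)_x is invariant and contains N x. *)
Lemma limg_cyclic N x : (N @: cyclic N x)%VS = cyclic N (N x).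
Proof.
apply/eqP; rewrite eqEsubv; apply/andP; split.
  have le : (cyclic N x <= N @^-1: cyclic N (N x))%VS.
    apply: cyclic_min; last by rewrite -memv_preim mem_cyclic_gen.
    apply/subvP => _ /memv_imgP [u uP ->].
    rewrite -memv_preim; apply: (subvP (Lat_cyclic N (N x))).
    by apply: memv_img; rewrite memv_preim.
  apply/subvP => _ /memv_imgP [u uC ->].
  by rewrite memv_preim (subvP le).
apply: cyclic_min; first exact: limgS (Lat_cyclic _ _).
exact: memv_img (mem_cyclic_gen _ _).
Qed.

(** The right-hand side contains x and is invariant, since N maps both summands into N C. *)
Lemma cyclic_sub_line_limg N x : (cyclic N x <= <[x]> + N @: cyclic N x)%VS.
Proof.
apply: cyclic_min; last exact: subvP (addvSl _ _) _ (memv_line x).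
rewrite /Lat /= limgD subv_add limg_line -memvE; apply/andP; split.
  by apply: subvP (addvSr _ _) _ _; exact: memv_img (mem_cyclic_gen _ _).
by apply: subv_trans (addvSr _ _); exact: limgS (Lat_cyclic _ _).
Qed.

Lemma nakayama_cyclic N P m x : iter m N x = 0 -> Lat N P ->
  (cyclic N x <= P + N @: cyclic N x)%VS -> (cyclic N x <= P)%VS.
Proof.
move=> xm0 LP le.
(* Applying N to the bound for k and using N P <= P gives N C <= P + (N)_{N^(k+1) x}, which the
   hypothesis turns into the bound for k + 1. At k = m the second summand vanishes. *)
suff H k : (cyclic N x <= P + cyclic N (iter k N x))%VS.
  have := H m; rewrite xm0 => /subv_trans; apply.
  by rewrite subv_add subvv cyclic_min ?mem0v // /Lat /= limg0 sub0v.
elim: k => [|k IH]; first exact: addvSr.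
apply: subv_trans le _; rewrite subv_add addvSl /=.
apply: subv_trans (limgS _ IH) _; rewrite limgD limg_cyclic.
exact: addvS LP (subvv _).
Qed.

Lemma Lat_sub_cyclic N P m x : iter m N x = 0 -> Lat N P ->
  (P <= cyclic N x)%VS ->
  exists2 k, (k <= m)%N & P = cyclic N (iter k N x).
Proof.
move=> + LP; elim: m x => [|m IH] x xm0 PC.
  (* Here x = 0, so C lies in any P. *)
  exists 0%N => //; apply/eqP; rewrite eqEsubv PC cyclic_min //.
  by move: xm0 => /= ->; exact: mem0v.
have [PNC|/subvPn [y yP yNC]] := boolP (P <= N @: cyclic N x)%VS.
  rewrite limg_cyclic in PNC.
  have [|k km ->] := IH (N x) _ PNC; first by rewrite -iterSr.
  by exists k.+1; rewrite // iterSr.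
exists 0%N => //; apply/eqP; rewrite eqEsubv PC (@nakayama_cyclic _ _ m.+1) //.
apply: subv_trans (cyclic_sub_line_limg N x) _; rewrite subv_add addvSr andbT.
(* Write y = a x + z with z in N C. As y is outside N C, a is non-zero, so x = a^-1 (y - z) lies in
   P + N C. *)
have /memv_addP [_ /vlineP [a ->] [z zNC yE]] :=
  subvP (cyclic_sub_line_limg N x) y (subvP PC y yP).
have a0 : a != 0.
  by apply: contraNneq yNC => a0; rewrite yE a0 scale0r add0r.
have xE : x = a^-1 *: (y - z) by rewrite yE addrK scalerK.
by rewrite -memvE {1}xE memvZ // memv_add // rpredN.
Qed.

Lemma is_cycle_cyclic N m x : iter m N x = 0 -> is_cycle N (cyclic N x).
Proof.
move=> xm0; split; first exact: Lat_cyclic.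
  (* Exponents run from 0 to m inclusive, hence [m.+1]; the exponent m gives the zero subspace. *)
  apply: (@sub_finite_set _ _ ((fun k => cyclic N (iter k N x)) @` `I_m.+1)).
    move=> P [LP _ /(Lat_sub_cyclic _ _ _ _ xm0 LP) [k km ->]].
    by exists k.
  exact/finite_image/finite_II.
move=> P Q [LP _ /(Lat_sub_cyclic _ _ _ _ xm0 LP) [i _ ->]].
move=> [LQ _ /(Lat_sub_cyclic _ _ _ _ xm0 LQ) [j _ ->]].
(* The order on exponents is reversed: the larger exponent gives the smaller subspace. *)
by case/orP: (leq_total j i) => /cyclic_iter_le; [left | right].
Qed.

End CyclicSubspaces.

Theorem lemma3 (R : realType) (V : vectType R[i]) (N : 'End(V))
    (N_neq0 : N <> 0) (N_nil : lfun_nilpotent N) (x : V) :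
  is_cycle N (cyclic N x).
Proof.
have [m Nm0] := N_nil; apply: (@is_cycle_cyclic _ _ N m).
by rewrite -lfun_expE Nm0 zero_lfunE.
Qed.
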